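(* Let $r>s\ge1$ be integers and let $G=\overline{\langle a_1,\dots,a_r\rangle}\subset W$ be the closed subgroup topologically generated by the elements $a_1,\dots,a_r\in W$ determined by $a_1=\sigma$, $a_{s+1}=(a_s,a_r)$, and $a_i=(a_{i-1},1)$ for $i\ne1,s+1$. Let $N:=\operatorname{Norm}_W(G)$. Then all odometers in $G$ are conjugate under $N$.
   Context: $T$ is the infinite rooted binary tree whose vertices are the finite words over $\{0,1\}$, with root the empty word, each word $t$ being joined by an edge to $t0$ and $t1$. $W:=\operatorname{Aut}(T)$ is its automorphism group, a profinite group as the inverse limit of the finite groups $W_n=\operatorname{Aut}(T_n)$, where $T_n\subset T$ is the subtree of words of length $\le n$. For $u,v\in W$, $(u,v)\in W$ denotes the automorphism $0t\mapsto 0\,u(t)$, $1t\mapsto 1\,v(t)$ for all words $t$; $\sigma\in W$ is the automorphism of order $2$ with $0t\mapsto 1t$ and $1t\mapsto 0t$. Thus $W=(W\times W)\rtimes\langle\sigma\rangle$. The recursion relations for $a_1,\dots,a_r$ have a unique solution in $W$. $\operatorname{Norm}_W(G)$ is the normalizer of $G$ in $W$. The standard odometer is the unique element $a\in W$ with $a=(a,1)\,\sigma$; an odometer is any element of $W$ that is conjugate to $a$ under $W$. *)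

(* Defs.v *)
From HB Require Import structures.
From mathcomp Require Import all_boot.
From mathcomp Require Import boolp classical_sets functions filter.
From mathcomp Require Import topology.

Set Implicit Arguments.
Unset Strict Implicit.
Unset Printing Implicit Defensive.

Local Open Scope classical_set_scope.
Local Open Scope group_scope.

(* Vertices of T are words over {0,1}, with letters 0 = false and 1 = true.
   The children t0, t1 of t are obtained by appending a letter, whereas the
   words 0t, 1t used in the wreath recursion are obtained by prepending one. *)
Definition word := seq bool.

Definition parent (s t : word) : Prop := exists b, t = rcons s b.

Definition adjacent (s t : word) : Prop := parent s t \/ parent t s.

Definition is_tree_automorphism (f : word -> word) : Prop :=
  [/\ bijective f, f [::] = [::] &
      forall s t, adjacent s t <-> adjacent (f s) (f t)].

Record W := TreeAut {
  aut_fun :> word -> word;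
  aut_funP : is_tree_automorphism aut_fun
}.

Lemma autP (u v : W) : u =1 v -> u = v.
Proof.
case: u v => [f fP] [g gP] /= /funext fg.
by case: _ / fg gP => gP; congr TreeAut; exact: Prop_irrelevance.
Qed.

Lemma aut_nil (u : W) : u [::] = [::].
Proof. by case: (aut_funP u). Qed.

Lemma aut_adjacent (u : W) s t : adjacent s t <-> adjacent (u s) (u t).
Proof. by case: (aut_funP u) => _ _; apply. Qed.

Lemma aut_bij (u : W) : bijective u.
Proof. by case: (aut_funP u). Qed.

Lemma aut_inv_exists (u : W) : exists g, cancel u g /\ cancel g u.
Proof. by case: (aut_bij u) => g ? ?; exists g. Qed.

Definition aut_inv_fun (u : W) : word -> word := sval (cid (aut_inv_exists u)).

Lemma aut_funK (u : W) : cancel u (aut_inv_fun u).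
Proof. by rewrite /aut_inv_fun; case: cid => g []. Qed.

Lemma aut_inv_funK (u : W) : cancel (aut_inv_fun u) u.
Proof. by rewrite /aut_inv_fun; case: cid => g []. Qed.

Lemma tree_automorphism_id : is_tree_automorphism id.
Proof. by split=> //; exists id. Qed.

Lemma tree_automorphism_comp (u v : W) : is_tree_automorphism (u \o v).
Proof.
split=> [||s t]; first exact: bij_comp (aut_bij u) (aut_bij v).
  by rewrite /= !aut_nil.
by rewrite (aut_adjacent v) (aut_adjacent u).
Qed.

Lemma tree_automorphism_inv (u : W) : is_tree_automorphism (aut_inv_fun u).
Proof.
split=> [||s t].
- by exists u; [exact: aut_inv_funK | exact: aut_funK].
- by rewrite -{1}(aut_nil u) aut_funK.
- by rewrite (aut_adjacent u (aut_inv_fun u s)) !aut_inv_funK.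
Qed.

Definition aut_one : W := TreeAut tree_automorphism_id.
(* W acts on the left: (u * v)(t) = u(v(t)). *)
Definition aut_mul (u v : W) : W := TreeAut (tree_automorphism_comp u v).
Definition aut_inv (u : W) : W := TreeAut (tree_automorphism_inv u).

Lemma aut_mulA : associative aut_mul.
Proof. by move=> u v w; apply/autP. Qed.

Lemma aut_mul1 : left_id aut_one aut_mul.
Proof. by move=> u; apply/autP. Qed.

Lemma aut_mulr1 : right_id aut_one aut_mul.
Proof. by move=> u; apply/autP. Qed.

Lemma aut_mulV : left_inverse aut_one aut_inv aut_mul.
Proof. by move=> u; apply/autP => t; exact: aut_funK. Qed.

Lemma aut_mulrV : right_inverse aut_one aut_inv aut_mul.
Proof. by move=> u; apply/autP => t; exact: aut_inv_funK. Qed.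

HB.instance Definition _ := gen_eqMixin W.
HB.instance Definition _ := gen_choiceMixin W.
HB.instance Definition _ :=
  isGroup.Build W aut_mulA aut_mul1 aut_mulr1 aut_mulV aut_mulrV.

(* The profinite topology of W = lim W_n: a neighbourhood basis of u consists
   of the cosets of the kernels of W -> W_n = Aut(T_n), i.e. of the sets of
   those v having the same restriction as u to the words of length <= n. *)
Definition level_nbhs (u : W) (n : nat) : set W :=
  [set v : W | forall t : word, size t <= n -> v t = u t].

Definition aut_nbhs (u : W) : set_system W :=
  filter_from setT (level_nbhs u).

HB.instance Definition _ := hasNbhs.Build W aut_nbhs.

Lemma aut_nbhs_filter (u : W) : ProperFilter (nbhs u).
Proof.
apply: filter_from_proper; last by move=> n _; exists u.
apply: filter_from_filter; first by exists 0%N.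
move=> m n _ _; exists (maxn m n) => // v uv.
by split=> t tn; apply: uv; rewrite leq_max tn ?orbT.
Qed.

Lemma aut_nbhs_singleton (u : W) (A : set W) : nbhs u A -> A u.
Proof. by move=> [n _]; apply. Qed.

Lemma aut_nbhs_nbhs (u : W) (A : set W) : nbhs u A -> nbhs u (nbhs^~ A).
Proof.
move=> [n _ nA]; exists n => // v uv; exists n => // w vw.
by apply: nA => t tn; rewrite vw ?uv.
Qed.

HB.instance Definition _ := Nbhs_isNbhsTopological.Build W
  aut_nbhs_filter aut_nbhs_singleton aut_nbhs_nbhs.

Definition generated_subgroup (A : set W) : set W :=
  smallest [set H : set W | group_closed [in H]] A.

Definition closed_subgroup_generated (A : set W) : set W :=
  closure (generated_subgroup A).

Definition normalizer (G : set W) : set W :=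
  [set w | (fun x => x ^ w) @` G = G].

Lemma parent_cons b c s t : parent (b :: s) (c :: t) <-> b = c /\ parent s t.
Proof.
split; first by case=> d [<- ->]; split=> //; exists d.
by case=> -> [d ->]; exists d.
Qed.

Lemma parent_nil_cons c t : parent [::] (c :: t) <-> t = [::].
Proof. by split=> [[d [_ ->]]//|->]; exists c. Qed.

Lemma parent_nil s : ~ parent s [::].
Proof. by case=> d /(congr1 size); rewrite size_rcons. Qed.

Lemma aut_eq_nil (u : W) t : u t = [::] <-> t = [::].
Proof.
split=> [|->]; last exact: aut_nil.
by rewrite -[in u t = _](aut_nil u) => /(bij_inj (aut_bij u)).
Qed.

Definition pair_fun (u v : word -> word) (t : word) : word :=
  if t is b :: t' then b :: (if b then v t' else u t') else [::].

Lemma tree_automorphism_pair (u v : W) : is_tree_automorphism (pair_fun u v).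
Proof.
split=> //.
  exists (pair_fun (aut_inv_fun u) (aut_inv_fun v)) => -[|[] t] //=.
  - by rewrite aut_funK.
  - by rewrite aut_funK.
  - by rewrite aut_inv_funK.
  - by rewrite aut_inv_funK.
case=> [|b s] [|c t] //=; rewrite /adjacent.
- by rewrite !parent_nil_cons; case: c; rewrite aut_eq_nil; split=> -[] //;
    (by left) || by move/parent_nil.
- by rewrite !parent_nil_cons; case: b; rewrite aut_eq_nil; split=> -[] //;
    (by right) || by move/parent_nil.
rewrite !parent_cons; case: b; case: c.
- have := aut_adjacent v s t; rewrite /adjacent => -[h1 h2].
  by split=> [[[_ /or_introl/h1]|[_ /or_intror/h1]]|
    [[_ /or_introl/h2]|[_ /or_intror/h2]]] [] *; (by left) || by right.
- by split=> -[] [].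
- by split=> -[] [].
- have := aut_adjacent u s t; rewrite /adjacent => -[h1 h2].
  by split=> [[[_ /or_introl/h1]|[_ /or_intror/h1]]|
    [[_ /or_introl/h2]|[_ /or_intror/h2]]] [] *; (by left) || by right.
Qed.

(* (u, v) : 0t |-> 0 u(t), 1t |-> 1 v(t). *)
Definition aut_pair (u v : W) : W := TreeAut (tree_automorphism_pair u v).

Definition sigma_fun (t : word) : word :=
  if t is b :: t' then ~~ b :: t' else [::].

Lemma parent_automorphism (f g : word -> word) :
    cancel f g -> cancel g f -> f [::] = [::] ->
    (forall s t, parent s t -> parent (f s) (f t)) ->
    (forall s t, parent s t -> parent (g s) (g t)) ->
  is_tree_automorphism f.
Proof.
move=> fK gK f0 fP gP; split=> [|//|s t]; first by exists g.
split=> -[] h; [left|right|left|right]; try exact: fP.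
  by rewrite -(fK s) -(fK t); apply: gP.
by rewrite -(fK s) -(fK t); apply: gP.
Qed.

Lemma tree_automorphism_sigma : is_tree_automorphism sigma_fun.
Proof.
have sK : involutive sigma_fun by case=> [|b t] //=; rewrite negbK.
have sP s t : parent s t -> parent (sigma_fun s) (sigma_fun t).
  by case: s => [|b s] [c ->]; [exists (~~ c) | exists c].
exact: (parent_automorphism sK sK).
Qed.

Definition sigma : W := TreeAut tree_automorphism_sigma.

Definition is_standard_odometer (a : W) : Prop := a = aut_pair a 1 * sigma.

Definition odometer (g : W) : Prop :=
  exists a w : W, is_standard_odometer a /\ g = a ^ w.

(* Addition of 1 with carry, least significant digit first, and its inverse. *)
Fixpoint add1 (t : word) : word :=
  if t is b :: t' then ~~ b :: (if b then add1 t' else t') else [::].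
Fixpoint sub1 (t : word) : word :=
  if t is b :: t' then ~~ b :: (if b then t' else sub1 t') else [::].

Lemma tree_automorphism_add1 : is_tree_automorphism add1.
Proof.
apply: (@parent_automorphism add1 sub1) => //.
- by elim=> [|[] t IHt] //=; rewrite IHt.
- by elim=> [|[] t IHt] //=; rewrite IHt.
- move=> s _ [c ->]; elim: s => [|b s [d IHs]] /=.
    by exists (~~ c); case: c.
  by case: b; [exists d; rewrite IHs | exists c].
- move=> s _ [c ->]; elim: s => [|b s [d IHs]] /=.
    by exists (~~ c); case: c.
  by case: b; [exists c | exists d; rewrite IHs].
Qed.

Lemma standard_odometer_exists_unique : exists! a, is_standard_odometer a.
Proof.
exists (TreeAut tree_automorphism_add1); split.
  by apply/autP => -[|[] t].
move=> b bE; apply/autP; elim=> [|c t IHt]; rewrite bE //=.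
by case: c => //=; rewrite -IHt.
Qed.

(* The wreath recursion defining a_1, ..., a_r; only the values of a at the
   indices 1, ..., r matter. *)
Definition generator_recursion (r s : nat) (a : nat -> W) : Prop :=
  [/\ a 1%N = sigma,
      a s.+1 = aut_pair (a s) (a r) &
      forall i, (1 <= i <= r)%N -> i <> 1%N -> i <> s.+1 ->
        a i = aut_pair (a i.-1) 1].

Fixpoint generator_fun (r s i : nat) (t : word) : word :=
  if t is b :: t' then
    if i == 1%N then ~~ b :: t'
    else b :: (if b then if i == s.+1 then generator_fun r s r t' else t'
               else generator_fun r s i.-1 t')
  else [::].

Lemma tree_automorphism_generator r s i :
  is_tree_automorphism (generator_fun r s i).
Proof.
have gK j : involutive (generator_fun r s j).
  move=> t; elim: t j => [|b t IHt] j //=.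
  have [j1|j1] /= := eqVneq j 1%N; rewrite ?j1 ?(negbTE j1) ?eqxx /= ?negbK //.
  case: b; rewrite ?IHt //.
  by have [_|_] := eqVneq j s.+1; rewrite ?IHt.
have gP j u v :
    parent u v -> parent (generator_fun r s j u) (generator_fun r s j v).
  case=> c ->; elim: u j => [|b u IHu] j /=.
    by case: ifP => _; [exists (~~ c) | exists c; case: c; rewrite ?if_same].
  case: ifP => _; first by exists c.
  apply/parent_cons; split=> //; case: b; last exact: IHu.
  by case: ifP => _; [exact: IHu | exists c].
by apply: (parent_automorphism (gK i) (gK i)) => //; exact: gP.
Qed.

Lemma generators_exist r s : (1 <= s < r)%N ->
  exists a, generator_recursion r s a.
Proof.
case/andP=> s0 sr; exists (fun i => TreeAut (tree_automorphism_generator r s i)).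
split=> [||i _ i1 is1]; apply/autP => -[|b t] //=.
  by rewrite eqxx eqSS eqn0Ngt s0 /=.
by move/eqP/negbTE: i1 => ->; move/eqP/negbTE: is1 => ->; case: b.
Qed.

Lemma generators_unique r s a a' : (1 <= s < r)%N ->
    generator_recursion r s a -> generator_recursion r s a' ->
  forall i, (1 <= i <= r)%N -> a i = a' i.
Proof.
case/andP=> s0 sr [a1 as1 ai] [a1' as1' ai'] i ir; apply/autP => t.
elim: t i ir => [|b t IHt] i ir; first by rewrite !aut_nil.
have [->|/eqP i1] := eqVneq i 1%N; first by rewrite a1 a1'.
have [->|/eqP is1] := eqVneq i s.+1.
  rewrite as1 as1' /=; case: b; rewrite IHt //.
    by rewrite leqnn andbT; case: (r) sr.
  by rewrite s0 ltnW.
rewrite ai // ai' //=; case: b => //; rewrite IHt //.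
by case: i i1 {is1} ir => [|[|i]] //= _ /ltnW.
Qed.

(* Main.v *)
From HB Require Import structures.
Require Import Defs.
From mathcomp Require Import all_boot.
From mathcomp Require Import boolp classical_sets.
From mathcomp Require Import filter topology.

Set Implicit Arguments.
Unset Strict Implicit.
Unset Printing Implicit Defensive.

Local Open Scope group_scope.

(** Any two odometers are conjugate under W, so it suffices that every w in W
    with g^w = h, for odometers g, h in G, normalizes G.  This is proved modulo
    the action on words of length n, by induction on n.  Multiplying w by g, one
    may take w = (u, v); with g = (b, c)sigma and h = (b', c')sigma, the element u
    conjugates the odometer bc to b'c', so u and v = b^-1 u b' normalize G modulo
    level n.  Now G /\ (W x W) is the set of pairs (x, y) in G x G with
    delta y = tau (delta x), where delta kills all generators but a_s and a_r, has
    a dihedral image D, and tau exchanges the images of a_s and a_r.  As tau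
    inverts the rotations of D and the image of bc generates them, the relation
    v = b^-1 u b' forces conjugation by (u, v) to preserve this set.  The group D
    has order 8 if s = 1 < r - 1 or (r, s) = (3, 2), and order 4 otherwise, except
    for (r, s) = (2, 1), when G itself is dihedral and w is handled directly. *)

(** * Sections of tree automorphisms *)

Lemma aut_rcons (u : W) t b : exists c, u (rcons t b) = rcons (u t) c.
Proof.
have adj s c : adjacent (u s) (u (rcons s c)).
  by apply: (aut_adjacent u _ _).1; left; exists c.
elim/last_ind: t b => [|t c IHt] b.
  case: (adj [::] b) => -[d]; first by exists d.
  by rewrite aut_nil => /(congr1 size); rewrite size_rcons.
case: (adj (rcons t c) b) => -[d]; first by exists d.
case: (IHt c) => c' -> /rcons_inj[/(bij_inj (aut_bij u)) /(congr1 size)].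
by rewrite !size_rcons => /eqP; rewrite -addn2 -[X in X == _]addn0 eqn_add2l.
Qed.

Lemma size_aut (u : W) t : size (u t) = size t.
Proof.
elim/last_ind: t => [|t b IHt]; first by rewrite aut_nil.
by case: (aut_rcons u t b) => c ->; rewrite !size_rcons IHt.
Qed.

Definition swap (u : W) : bool := head false (u [:: false]).

(** Prefixes are preserved, so the first letter of the image depends on [b] alone; injectivity on
    words of length 1 makes this dependence a translation. *)
Lemma aut_cons (u : W) b t : u (b :: t) = (b (+) swap u) :: behead (u (b :: t)).
Proof.
elim/last_ind: t => [|t c IHt]; last first.
  by case: (aut_rcons u (b :: t) c) => d; rewrite rcons_cons => ->; rewrite IHt.
have u1 c : u [:: c] = [:: head false (u [:: c])].
  by have := size_aut u [:: c]; case: (u [:: c]) => [|x []].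
suff <- : head false (u [:: b]) = b (+) swap u by rewrite u1.
case: b => //=; have : u [:: true] <> u [:: false].
  by move/(bij_inj (aut_bij u)).
by rewrite /swap (u1 true) (u1 false) /=; do 2?case: (head _ _).
Qed.

(* The section at the letter [b] of the source: [u (b t) = b' (sec u b t)]. *)
Lemma tree_automorphism_sec (u : W) b :
  is_tree_automorphism (fun t => behead (u (b :: t))).
Proof.
have P (w : W) c s t : parent s t ->
    parent (behead (w (c :: s))) (behead (w (c :: t))).
  case=> d ->; case: (aut_rcons w (c :: s) d) => d'.
  by rewrite rcons_cons => ->; exists d'; rewrite aut_cons.
(* The inverse of a section is the section of [u^-1] at the image letter. *)
apply: (@parent_automorphism _ (fun t => behead (u^-1 ((b (+) swap u) :: t)))).
- by move=> t /=; rewrite -aut_cons aut_funK.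
- move=> t /=.
  have := aut_cons u^-1 (b (+) swap u) t; have := aut_cons u^-1 (b (+) swap u) [::].
  set d := _ (+) swap u^-1 => _ E.
  suff db : d = b by rewrite -{1}db -E aut_inv_funK.
  have := aut_inv_funK u ((b (+) swap u) :: t).
  rewrite [aut_inv_fun _ _]E aut_cons => -[].
  by case: d {E}; case: b; case: (swap u).
- by have := size_aut u [:: b]; case: (u _) => [|x []].
- by move=> s t; apply: P.
- by move=> s t; apply: P.
Qed.

Definition sec (u : W) b : W := TreeAut (tree_automorphism_sec u b).

Lemma autE (u : W) b t : u (b :: t) = (b (+) swap u) :: sec u b t.
Proof. exact: aut_cons. Qed.

Lemma mulWE (u v : W) t : (u * v) t = u (v t).
Proof. by []. Qed.

Lemma oneWE t : (1 : W) t = t.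
Proof. by []. Qed.

Lemma swap_sec_unique (u : W) c (f : bool -> W) :
    (forall b t, u (b :: t) = (b (+) c) :: f b t) ->
  swap u = c /\ forall b, sec u b = f b.
Proof.
move=> uE; have cE : swap u = c by rewrite /swap uE.
by split=> // b; apply/autP => t; have := autE u b t; rewrite uE => -[].
Qed.

Lemma swap_secM (u v : W) : swap (u * v) = swap u (+) swap v /\
  forall b, sec (u * v) b = sec u (b (+) swap v) * sec v b.
Proof.
apply: swap_sec_unique => b t.
by rewrite !mulWE !autE -addbA (addbC (swap v)).
Qed.

Lemma swapM (u v : W) : swap (u * v) = swap u (+) swap v.
Proof. by case: (swap_secM u v). Qed.

Lemma secM (u v : W) b : sec (u * v) b = sec u (b (+) swap v) * sec v b.
Proof. by case: (swap_secM u v). Qed.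

Lemma swap1 : swap 1 = false.
Proof. by []. Qed.

Lemma sec1 b : sec 1 b = 1.
Proof. exact/autP. Qed.

Lemma swapV (u : W) : swap u^-1 = swap u.
Proof. by have := swap1; rewrite -(mulVg u) swapM; do 2!case: swap. Qed.

Lemma secV (u : W) b : sec u^-1 b = (sec u (b (+) swap u))^-1.
Proof.
apply: (mulIg (sec u (b (+) swap u))); rewrite mulVg.
by have := secM u^-1 u (b (+) swap u); rewrite -addbA addbb addbF mulVg sec1.
Qed.

Lemma swap_sigma : swap sigma = true.
Proof. by []. Qed.

Lemma sec_sigma b : sec sigma b = 1.
Proof. exact/autP. Qed.

Lemma swap_pair (u v : W) : swap (aut_pair u v) = false.
Proof. by []. Qed.

Lemma sec_pair (u v : W) b : sec (aut_pair u v) b = if b then v else u.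
Proof. by apply/autP => t; case: b. Qed.

Definition secE := (secM, secV, sec1, sec_sigma, sec_pair,
  swapM, swapV, swap1, swap_sigma, swap_pair).

Lemma aut_ext (u v : W) :
  swap u = swap v -> sec u false = sec v false -> sec u true = sec v true -> u = v.
Proof.
move=> e0 e1 e2; apply/autP => -[|b t]; first by rewrite !aut_nil.
by rewrite !autE e0; case: b; rewrite ?e1 ?e2.
Qed.

(** * Congruence modulo a level, and signatures *)

Definition level_eq n (u v : W) := forall t : word, size t <= n -> u t = v t.

Lemma level_eq_refl n u : level_eq n u u. Proof. by []. Qed.

Lemma level_eq_sym n u v : level_eq n u v -> level_eq n v u.
Proof. by move=> uv t tn; rewrite uv. Qed.

Lemma level_eq_trans n v u w : level_eq n u v -> level_eq n v w -> level_eq n u w.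
Proof. by move=> uv vw t tn; rewrite uv ?vw. Qed.

Lemma level_eqM n u u' v v' :
  level_eq n u u' -> level_eq n v v' -> level_eq n (u * v) (u' * v').
Proof. by move=> uu vv t tn; rewrite !mulWE vv // uu // size_aut. Qed.

Lemma level_eqV n u v : level_eq n u v -> level_eq n u^-1 v^-1.
Proof.
move=> uv t tn; rewrite -{1}[t]oneWE -(mulgV v) mulWE -uv ?size_aut //.
by rewrite -mulWE mulVg.
Qed.

Lemma level_eqJ n u v x y :
  level_eq n u v -> level_eq n x y -> level_eq n (u ^ x) (v ^ y).
Proof. by move=> uv xy; do 2?apply: level_eqM => //; apply: level_eqV. Qed.

Lemma level_eq0 u v : level_eq 0 u v.
Proof. by case=> // _; rewrite !aut_nil. Qed.

Lemma level_eqS n u v : level_eq n.+1 u v <->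
  swap u = swap v /\ forall b, level_eq n (sec u b) (sec v b).
Proof.
split=> [uv|[e uv]]; last first.
  by case=> [|b t] tn; rewrite ?aut_nil // !autE e uv.
split=> [|b t tn]; first by rewrite /swap uv.
by have := uv (b :: t) tn; rewrite !autE => -[].
Qed.

(* The signature, in {0, 1}, of the action of [u] on the words of length [n]
   (for n >= 1; a dummy value for n = 0). *)
Fixpoint sgn n (u : W) : bool :=
  match n with
  | 0 => false
  | 1 => swap u
  | m.+1 => sgn m (sec u false) (+) sgn m (sec u true)
  end.

Arguments sgn : simpl never.

Lemma sgn1E u : sgn 1 u = swap u. Proof. by []. Qed.

Lemma sgnSS n u : sgn n.+2 u = sgn n.+1 (sec u false) (+) sgn n.+1 (sec u true).
Proof. by []. Qed.

(** A swap in [v] only exchanges the two sections of [u], and the sum of their signatures is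
    symmetric. *)
Lemma sgnM n u v : sgn n (u * v) = sgn n u (+) sgn n v.
Proof.
elim: n u v => // -[|n] IHn u v; first exact: swapM.
rewrite !sgnSS !secM !IHn addbACA; congr (_ (+) _).
by case: (swap v) => //; rewrite addbC.
Qed.

Lemma sgn_one n : sgn n 1 = false.
Proof. by elim: n => // -[|n] IHn; rewrite // sgnSS !sec1 IHn. Qed.

Lemma sgnV n u : sgn n u^-1 = sgn n u.
Proof.
by have := sgn_one n; rewrite -(mulVg u) sgnM; do 2!case: sgn.
Qed.

Lemma sgnJ n u v : sgn n (u ^ v) = sgn n u.
Proof. by rewrite conjgE !sgnM sgnV; do 2!case: sgn. Qed.

Lemma sgn_pair n u v : sgn n.+2 (aut_pair u v) = sgn n.+1 u (+) sgn n.+1 v.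
Proof. by rewrite sgnSS !sec_pair. Qed.

Lemma sgn_level n m u v : m <= n -> level_eq n u v -> sgn m u = sgn m v.
Proof.
elim: n m u v => [|n IHn] [|[|m]] u v //; first by move=> _ /level_eqS[].
by move=> mn /level_eqS[_ uv]; rewrite !sgnSS !(IHn m.+1 _ _ mn (uv _)).
Qed.

(** The standard odometer has sections 1 and itself, which gives the induction. From here on
    odometers are known only by these signatures. *)
Lemma sgn_odometer n g : odometer g -> sgn n.+1 g.
Proof.
case=> a [w [aE ->]]; rewrite sgnJ; elim: n => [|n IHn].
  by rewrite sgn1E aE !secE.
rewrite sgnSS aE !secM !sec_sigma !mulg1 !sec_pair swap_sigma.
by rewrite [X in X (+) _](sgn_one n.+1) addFb.
Qed.

Lemma aut_pairM x y x' y' :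
  aut_pair x y * aut_pair x' y' = aut_pair (x * x') (y * y').
Proof. by apply: aut_ext; rewrite !secE. Qed.

Lemma aut_pairV x y : (aut_pair x y)^-1 = aut_pair x^-1 y^-1.
Proof. by apply: aut_ext; rewrite !secE. Qed.

Lemma pair_sigma x y : aut_pair x y ^ sigma = aut_pair y x.
Proof. by apply: aut_ext; rewrite conjgE !secE ?(invg1, mulg1, mul1g). Qed.

Lemma pair_comm x y : aut_pair x 1 * aut_pair 1 y = aut_pair 1 y * aut_pair x 1.
Proof. by rewrite !aut_pairM !mulg1 !mul1g. Qed.

(** * Orbits and centralizers of odometers *)

Lemma aut_cat (u : W) t t' : exists t2, u (t ++ t') = u t ++ t2.
Proof.
elim/last_ind: t' => [|t' b [t2 IHt]]; first by exists [::]; rewrite !cats0.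
case: (aut_rcons u (t ++ t') b) => c; rewrite -rcons_cat => ->.
by exists (rcons t2 c); rewrite IHt rcons_cat.
Qed.

Lemma level_eq_size n (u v : W) :
  (forall t, size t = n -> u t = v t) -> level_eq n u v.
Proof.
move=> uv t tn; have := uv (t ++ nseq (n - size t) false).
rewrite size_cat size_nseq subnKC // => /(_ erefl).
case: (aut_cat u t (nseq (n - size t) false)) => t1 ->.
case: (aut_cat v t (nseq (n - size t) false)) => t2 -> /(congr1 (take (size t))).
rewrite -[X in take X _ = _](size_aut u) -[X in _ = take X _](size_aut v).
by rewrite !take_size_cat.
Qed.

Lemma expg_cons (x : W) k b t : swap x = false ->
  (x ^+ k) (b :: t) = b :: (sec x b ^+ k) t.
Proof.
move=> x0; elim: k t => // k IHk t.
by rewrite !expgSr !mulWE autE x0 addbF IHk.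
Qed.

(** The sections of [g ^+ 2] are the products of the two sections of [g], in either order; these
    again have all signatures 1, which drives the induction. *)
Lemma odometer_transitive n g t t' : (forall j, sgn j.+1 g) ->
  size t = n -> size t' = n -> exists k, (g ^+ k) t = t'.
Proof.
elim: n g t t' => [|n IHn] g [|b t] [|b' t'] // go; first by exists 0%N.
have g1 : swap g by rewrite -sgn1E.
have same c t1 t2 : size t1 = n -> size t2 = n ->
    exists k, (g ^+ k) (c :: t1) = c :: t2.
  have ggo j : sgn j.+1 (sec (g ^+ 2) c).
    have := go j.+1; rewrite sgnSS expg2 secM g1 sgnM; case: c => //=.
    by rewrite addbC.
  move=> E1 E2; have [k kE] := IHn _ t1 t2 ggo E1 E2.
  by exists (2 * k)%N; rewrite expgnA expg_cons ?kE // expg2 swapM addbb.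
move=> [tn] [tn']; have [->|bb'] := eqVneq b b'; first exact: same.
have [k kE] := same b' (sec g b t) t' (etrans (size_aut _ _) tn) tn'.
exists k.+1; rewrite expgSr mulWE autE g1 -kE.
by case: (b) (b') bb' => [] [].
Qed.

(** A map commuting with a transitive cyclic group is determined by the image of one word, here the
    zero word. *)
Lemma odometer_centralizer n h z : (forall j, sgn j.+1 h) ->
  level_eq n (z * h) (h * z) -> exists k, level_eq n z (h ^+ k).
Proof.
move=> ho zh; have zhX k t : size t = n -> z ((h ^+ k) t) = (h ^+ k) (z t).
  move=> tn; elim: k => // k IHk.
  rewrite expgS !mulWE -IHk -(mulWE z) zh ?size_aut ?tn //.
have t0n : size (nseq n false) = n by rewrite size_nseq.
have [k kE] := odometer_transitive ho t0n (etrans (size_aut z _) t0n).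
exists k; apply: level_eq_size => t tn.
have [j jE] := odometer_transitive ho t0n tn.
by rewrite -jE zhX // -kE -!mulWE -!expgnDr addnC.
Qed.

(** * Dihedral groups *)

(** The step from an even word [z] in the involutions [p] and [q] to one longer by two letters, for
    the infinite dihedral case. *)
Lemma rotation_inverted (G : groupType) (p q z : G) : p * p = 1 -> q * q = 1 ->
    z ^ p = z^-1 -> z ^ q = z^-1 ->
  (p * q * z) ^ p = (p * q * z)^-1 /\ (p * q * z) ^ q = (p * q * z)^-1.
Proof.
move=> pp qq zp zq; have [pV qV] := (mulg1_eq pp, mulg1_eq qq).
have [zpE zqE] : z * p = p * z^-1 /\ z * q = q * z^-1.
  by rewrite !(conjgC z) zp zq.
have zV t : t * t = 1 -> z * t = t * z^-1 -> z^-1 * t = t * z.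
  move=> tt zt; apply: (mulgI z); rewrite mulVKg mulgA zt mulgVK //.
have pK t : p * (p * t) = t by rewrite mulgA pp mul1g.
have qK t : q * (q * t) = t by rewrite mulgA qq mul1g.
rewrite !conjgE !invgM pV qV -!mulgA zpE zqE !(mulgA z^-1) (zV q) // -!mulgA.
rewrite zpE pK qK; split=> //.
Qed.

(* The dihedral group of order 8, as the wreath product of {0, 1} with the
   group of order 2: [Dih p q e] multiplies like an automorphism with sections
   of signatures [p] and [q] at 0 and 1 and with [swap] equal to [e]. *)
Record dih := Dih { dih0 : bool; dih1 : bool; dihs : bool }.

HB.instance Definition _ := gen_eqMixin dih.
HB.instance Definition _ := gen_choiceMixin dih.

Definition dih_mul x y :=
  Dih ((if dihs y then dih1 x else dih0 x) (+) dih0 y)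
      ((if dihs y then dih0 x else dih1 x) (+) dih1 y) (dihs x (+) dihs y).
Definition dih_one := Dih false false false.
Definition dih_inv x := if dihs x then Dih (dih1 x) (dih0 x) true else x.

Lemma dih_mulA : associative dih_mul.
Proof. by move=> [[] [] []] [[] [] []] [[] [] []]. Qed.

Lemma dih_mul1 : left_id dih_one dih_mul.
Proof. by move=> [[] [] []]. Qed.

Lemma dih_mulr1 : right_id dih_one dih_mul.
Proof. by move=> [[] [] []]. Qed.

Lemma dih_mulV : left_inverse dih_one dih_inv dih_mul.
Proof. by move=> [[] [] []]. Qed.

Lemma dih_mulrV : right_inverse dih_one dih_inv dih_mul.
Proof. by move=> [[] [] []]. Qed.

HB.instance Definition _ :=
  isGroup.Build dih dih_mulA dih_mul1 dih_mulr1 dih_mulV dih_mulrV.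

(* The automorphism exchanging the generators [Dih 0 0 1] and [Dih 1 0 0]. *)
Definition dih_tau x :=
  let e := dih0 x (+) dih1 x in
  Dih (dih1 x (+) (dihs x && ~~ e)) (dih1 x (+) (dihs x && e)) e.

Lemma dih_tauM : {morph dih_tau : x y / x * y}.
Proof. by move=> [[] [] []] [[] [] []]. Qed.

Lemma dih_tauK : involutive dih_tau.
Proof. by move=> [[] [] []]. Qed.

(* In the dihedral group [dih_tau] acts on rotations by inversion. If [b = tau c] and
   [b * c] generates the rotations, then [b] and [c] are reflections, and the
   image under [u] of a reflection is determined by that of [b * c]. *)
Lemma dih_conj (b c b' c' u v x0 x1 : dih) :
  dihs (b * c) -> dih0 (b * c) (+) dih1 (b * c) ->
  b = dih_tau c -> b' = dih_tau c' -> x1 = dih_tau x0 ->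
  c * u = v * c' -> b * v = u * b' -> x1 ^ v = dih_tau (x0 ^ u).
Proof.
move=> odd1 odd2 bE b'E -> cu; have -> : v = c * u * c'^-1 by rewrite cu mulgK.
(* With [b = dih_tau c], the oddness assumptions on [b * c] force [c] to be a reflection; the rest
   is a finite check. *)
have {odd1 odd2} : dihs c (+) dih0 c (+) dih1 c.
  by move: odd1 odd2; rewrite bE; case: (c) => [[] [] []].
rewrite {}bE {}b'E; case: c {cu} => [[] [] []] // _.
all: by case: c' => [[] [] []]; case: u => [[] [] []] // _; case: x0 => [[] [] []].
Qed.

(** * The generators, and G modulo a level *)

Section Generators.
Local Open Scope classical_set_scope.

Variables (r s : nat) (a : nat -> W).
Hypotheses (s_ge1 : (1 <= s)%N) (s_lt_r : (s < r)%N).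
Hypothesis a_rec : generator_recursion r s a.

Definition gen_index i := (1 <= i <= r)%N.

Lemma gen1E : a 1%N = sigma. Proof. by case: a_rec. Qed.

Lemma gensE : a s.+1 = aut_pair (a s) (a r). Proof. by case: a_rec. Qed.

Lemma genSE i : (0 < i < r)%N -> i != s -> a i.+1 = aut_pair (a i) 1.
Proof.
case/andP=> i0 ir /eqP iNs; case: a_rec => _ _ -> //.
  by case: i i0 {ir iNs}.
by case.
Qed.

Lemma index1 : gen_index 1. Proof. by rewrite /gen_index (leq_trans _ s_lt_r). Qed.
Lemma indexr : gen_index r. Proof. by rewrite /gen_index leqnn andbT (leq_trans _ s_lt_r). Qed.
Lemma indexs : gen_index s. Proof. by rewrite /gen_index s_ge1 ltnW. Qed.

Variant gen_spec i : W -> Type :=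
  | Gen1 of i = 1%N : gen_spec i sigma
  | Gens of i = s.+1 : gen_spec i (aut_pair (a s) (a r))
  | GenS j of i = j.+1 & gen_index j & j != s & j != r : gen_spec i (aut_pair (a j) 1).

Lemma genP i : gen_index i -> gen_spec i (a i).
Proof.
case: i => [|[|j]] // /andP[_ jr]; first by rewrite gen1E; constructor.
have [->|jNs] := eqVneq j.+1 s; first by rewrite gensE; constructor.
rewrite genSE //; apply: (GenS (j := j.+1)) => //; last by rewrite neq_ltn jr.
exact: ltnW.
Qed.

Lemma gen_invol i : gen_index i -> a i * a i = 1.
Proof.
move=> ir; apply/autP => t; elim: t i ir => [|b t IHt] i ir; first exact: aut_nil.
case: (genP ir) => [_|_|j _ jr _ _].
- by rewrite !mulWE /= negbK.
- by case: b; rewrite mulWE /= -mulWE IHt ?indexr ?indexs.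
- by case: b => //; rewrite mulWE /= -mulWE IHt.
Qed.

Lemma genV i : gen_index i -> (a i)^-1 = a i.
Proof. by move=> /gen_invol/mulg1_eq. Qed.

(** For [i = s.+1] the signature of [a r] enters one level lower, so it vanishes as long as
    [j <= r]; at level [r.+1] it is 1 and the formula fails. *)
Lemma sgn_gen j i : gen_index i -> (j <= r)%N -> sgn j (a i) = (j == i).
Proof.
elim: j i => [|[|j] IHj] i ir jr; first by case: i ir.
  by case: (genP ir) => [->|->|k -> /andP[+ _] _ _] //;
     rewrite sgn1E swap_pair ?eqSS; [case: (s) s_ge1 | case: k].
have jr' := ltnW jr; have jNr : (j.+1 == r) = false by rewrite ltn_eqF.
case: (genP ir) => [->|->|k -> kr _ _].
- by rewrite sgnSS !sec_sigma !sgn_one.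
- by rewrite sgn_pair !IHj ?indexr ?indexs // jNr addbF eqSS.
- by rewrite sgn_pair IHj // sgn_one addbF eqSS.
Qed.

Lemma gen_trivial i n : gen_index i -> (n < i)%N -> level_eq n (a i) 1.
Proof.
elim: n i => [|n IHn] i ir ni; first exact: level_eq0.
move: ni; case: (genP ir) => [->|->|j -> jr _ _] // ni; apply/level_eqS; split=> //.
  case; rewrite sec_pair sec1; apply: IHn; rewrite ?indexr ?indexs //.
  exact: leq_trans (ni : n < s)%N (ltnW s_lt_r).
by case; rewrite sec_pair sec1 //; apply: IHn.
Qed.

(** As the generators are involutions, their products already form a group. *)
Inductive gam : W -> Prop :=
  | gam_1 : gam 1
  | gam_cons i x of gen_index i & gam x : gam (a i * x).

Lemma gam_gen i : gen_index i -> gam (a i).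
Proof. by move=> ir; rewrite -(mulg1 (a i)); apply: gam_cons gam_1. Qed.

Lemma gamM x y : gam x -> gam y -> gam (x * y).
Proof.
elim=> [|i x' ir _ IHx] gy; first by rewrite mul1g.
by rewrite -mulgA; apply: gam_cons => //; apply: IHx.
Qed.

Lemma gamV x : gam x -> gam x^-1.
Proof.
elim=> [|i x' ir _ IHx]; first by rewrite invg1; exact: gam_1.
by rewrite invgM genV //; apply: gamM IHx (gam_gen ir).
Qed.

Lemma gamJ x y : gam x -> gam y -> gam (x ^ y).
Proof. by move=> gx gy; apply: gamM (gamV gy) (gamM gx gy). Qed.

Lemma gam_sec x b : gam x -> gam (sec x b).
Proof.
move=> gx; elim: gx b => [|i x' ir _ IHx] b; first by rewrite sec1; exact: gam_1.
rewrite secM; apply: gamM => //.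
case: (genP ir) => [_|_|j _ jr _ _]; rewrite ?sec_sigma ?sec_pair.
- exact: gam_1.
- by case: (_ (+) _); apply: gam_gen; rewrite ?indexr ?indexs.
- by case: (_ (+) _); [exact: gam_1 | exact: gam_gen].
Qed.

(** Self-replication: [a s] is the section at 0 of [a s.+1], [a r] that of its conjugate by sigma,
    and any other [a i] that of [a i.+1]. *)
Lemma gam_lift x : gam x -> exists y, [/\ gam y, swap y = false & sec y false = x].
Proof.
elim=> [|i x' ir _ [y [gy y0 yx]]].
  by exists 1; rewrite sec1; split=> //; exact: gam_1.
suff [z [gz z0 zi]] : exists z, [/\ gam z, swap z = false & sec z false = a i].
  by exists (z * y); split; rewrite ?swapM ?secM ?z0 ?y0 ?yx ?zi //; apply: gamM.
have gs : gam (a s.+1) by apply: gam_gen.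
have [->|iNs] := eqVneq i s.
  by exists (a s.+1); split=> //; rewrite gensE ?swap_pair ?sec_pair.
have [->|iNr] := eqVneq i r.
  exists (a s.+1 ^ sigma); rewrite conjgE gensE; split; rewrite ?secE ?mulg1 //.
    by rewrite -gensE -gen1E; apply: gamJ => //; apply: gam_gen index1.
  by rewrite invg1 mul1g.
have ir' : (0 < i < r)%N by case/andP: ir => -> /=; rewrite ltn_neqAle iNr.
exists (a i.+1); rewrite genSE // ?swap_pair ?sec_pair -?genSE //; split=> //.
by apply: gam_gen; case/andP: ir'.
Qed.

Definition Glevel n w := exists2 x, gam x & level_eq n x w.

Lemma gam_Glevel n x : gam x -> Glevel n x.
Proof. by exists x. Qed.

Lemma Glevel1 n : Glevel n 1. Proof. exact/gam_Glevel/gam_1. Qed.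

Lemma Glevel_gen n i : gen_index i -> Glevel n (a i).
Proof. by move=> ir; apply/gam_Glevel/gam_gen. Qed.

Lemma Glevel_sigma n : Glevel n sigma.
Proof. by rewrite -gen1E; apply/Glevel_gen/index1. Qed.

Lemma GlevelM n x y : Glevel n x -> Glevel n y -> Glevel n (x * y).
Proof.
by case=> x' gx xx [y' gy yy]; exists (x' * y'); [exact: gamM | exact: level_eqM].
Qed.

Lemma GlevelV n x : Glevel n x -> Glevel n x^-1.
Proof. by case=> x' gx xx; exists x'^-1; [exact: gamV | exact: level_eqV]. Qed.

Lemma GlevelJ n x y : Glevel n x -> Glevel n y -> Glevel n (x ^ y).
Proof. by move=> gx gy; apply: GlevelM (GlevelV gy) (GlevelM gx gy). Qed.

Lemma Glevel_eq n x y : level_eq n x y -> Glevel n x -> Glevel n y.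
Proof. by move=> xy [z gz zx]; exists z => //; apply: level_eq_trans xy. Qed.

Lemma Glevel_sec n x b : Glevel n.+1 x -> Glevel n (sec x b).
Proof.
by case=> z gz /level_eqS[_ zx]; exists (sec z b); [exact: gam_sec | exact: zx].
Qed.

Lemma generated_subgroupE :
  generated_subgroup (a @` [set i | (1 <= i <= r)%N]) = [set x | gam x].
Proof.
apply/seteqP; split=> x /=; last first.
  move=> gx H [[H1 HB] aH].
  elim: gx => [|i y ir gy IHy]; first by rewrite inE in H1.
  have Hi : H (a i) by apply: aH; exists i.
  have /set_mem : y^-1 \in H.
    by rewrite -div1g; apply: HB => //; rewrite inE.
  by move/mem_set => Hy; move/mem_set: Hi => /HB/(_ Hy); rewrite invgK inE.
apply; split=> [|_ [i ir <-]]; last exact: gam_gen.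
split; first by rewrite inE; exact: gam_1.
by move=> u v; rewrite !inE => gu gv; apply: gamM gu (gamV gv).
Qed.

Lemma closed_subgroup_generatedE g :
  closed_subgroup_generated (a @` [set i | (1 <= i <= r)%N]) g <->
  forall n, Glevel n g.
Proof.
rewrite /closed_subgroup_generated generated_subgroupE; split.
  move=> gG n; case: (gG (level_nbhs g n)); first by exists n.
  by move=> x [/= gx xg]; exists x => // t tn; rewrite xg.
by move=> gG B [n _ nB]; case: (gG n) => x gx xg; exists x; split=> //; apply: nB.
Qed.

Lemma Glevel_pair_true n y : Glevel n (aut_pair y 1) -> Glevel n (aut_pair 1 y).
Proof.
move/GlevelJ/(_ (Glevel_sigma n)); congr Glevel.
by apply: aut_ext; rewrite conjgE !secE ?(invg1, mulg1, mul1g).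
Qed.

(** * Elements acting below a single vertex *)

(** Modulo level [n] this is a normal subgroup of G containing all generators other than [a s] and
    [a r]; the quotient by it is the group D to be identified. *)
Definition vertex_kernel n y := Glevel n.+1 (aut_pair y 1).

Lemma vertex_kernel1 n : vertex_kernel n 1.
Proof.
rewrite /vertex_kernel; suff -> : aut_pair 1 1 = 1 by exact: Glevel1.
by apply: aut_ext; rewrite !secE.
Qed.

Lemma vertex_kernelM n x y :
  vertex_kernel n x -> vertex_kernel n y -> vertex_kernel n (x * y).
Proof. by move=> kx ky; have := GlevelM kx ky; rewrite aut_pairM mulg1. Qed.

(** Conjugate by a lift of [y] fixing the first letter; the trivial component at 1 stays trivial. *)
Lemma vertex_kernelJ n x y : gam y -> vertex_kernel n x -> vertex_kernel n (x ^ y).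
Proof.
case/gam_lift=> z [gz z0 zy] /GlevelJ/(_ (gam_Glevel n.+1 gz)).
congr Glevel; apply: aut_ext; rewrite conjgE !secE z0 ?zy //.
by rewrite mul1g mulVg.
Qed.

Lemma vertex_kernel_eq n x y : level_eq n x y -> vertex_kernel n x -> vertex_kernel n y.
Proof. by move=> xy; apply: Glevel_eq; apply/level_eqS; split=> // -[]; rewrite !sec_pair. Qed.

Lemma vertex_kernel_gen n i : gen_index i -> i != s -> i != r -> vertex_kernel n (a i).
Proof.
move=> /andP[i0 ir] iNs iNr.
have ir' : (0 < i < r)%N by rewrite i0 ltn_neqAle iNr.
by rewrite /vertex_kernel -genSE //; apply: Glevel_gen; case/andP: ir'.
Qed.

(** G acts on the first [r] levels as all of W: [a r] is trivial on words shorter than [r], so on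
    words of length at most [r] the generator [a s.+1] acts as ([a s], 1), and all generators enter
    the vertex kernel. *)
Lemma Glevel_small n x : (n <= r)%N -> Glevel n x.
Proof.
elim: n x => [|n IHn] x nr; first by exists 1; [exact: gam_1 | exact: level_eq0].
have kerT y : vertex_kernel n y.
  have [z gz zy] := IHn y (ltnW nr); apply: (vertex_kernel_eq zy).
  elim: gz => [|i w ir gw IHw]; first exact: vertex_kernel1.
  apply: vertex_kernelM => //.
  have [->|iNr] := eqVneq i r.
    apply: vertex_kernel_eq (vertex_kernel1 n).
    exact/level_eq_sym/(gen_trivial indexr nr).
  have [->|iNs] := eqVneq i s; last exact: vertex_kernel_gen.
  apply: Glevel_eq (Glevel_gen n.+1 (i := s.+1) _) => //.
  rewrite gensE; apply/level_eqS; split=> // -[]; rewrite !sec_pair //.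
  exact: (gen_trivial indexr nr).
suff E y : swap y = false -> Glevel n.+1 y.
  case e: (swap x); last exact: E.
  rewrite -(mulgK sigma x); apply: GlevelM; last exact/GlevelV/Glevel_sigma.
  by apply: E; rewrite swapM e.
move=> y0; have -> : y = aut_pair (sec y false) 1 * aut_pair 1 (sec y true).
  by apply: aut_ext; rewrite !secE ?y0 ?mulg1 ?mul1g.
by apply: GlevelM; [exact: kerT | exact/Glevel_pair_true/kerT].
Qed.

(** * The claim proved by induction on the level *)

(** The elements [g] and [h] lie in G at every level, while the conclusion is at level [n]. The
    signature condition passes to the product of the two sections. *)
Definition odometer_normal n := forall g h w : W,
  (forall m, Glevel m g) -> (forall m, Glevel m h) ->
  (forall j, sgn j.+1 g) -> (forall j, sgn j.+1 h) -> g * w = w * h ->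
  forall x, Glevel n x -> Glevel n (x ^ w).

Lemma odometer_normal_small n : (n <= r)%N -> odometer_normal n.
Proof. by move=> nr g h w _ _ _ _ _ x _; apply: Glevel_small. Qed.

Lemma odometer_normal_normalizer (G : set W) g h w :
  G = closed_subgroup_generated (a @` [set i | (1 <= i <= r)%N]) ->
  (forall n, odometer_normal n) ->
  G g -> G h -> odometer g -> odometer h -> h = g ^ w -> normalizer G w.
Proof.
move=> GE P; have GP x : G x <-> forall n, Glevel n x.
  by rewrite GE; exact: closed_subgroup_generatedE.
move=> /GP gG /GP hG /sgn_odometer-/(_ _)-go /sgn_odometer-/(_ _)-ho hE.
have gw : g * w = w * h by rewrite hE -conjgC.
(* The inverse of [w] carries [h] back to [g], which gives the reverse inclusion. *)
have hw : h * w^-1 = w^-1 * g by rewrite -(mulgK w g) gw !mulgA mulVg mul1g.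
apply/seteqP; split=> [_ [x /GP xG <-]|x /GP xG].
  by apply/GP => n; apply: (P n _ _ _ gG hG).
exists (x ^ w^-1); last exact: conjgKV.
by apply/GP => n; apply: (P n _ _ _ hG gG).
Qed.

(** * The inductive step, for an abstract quotient D *)

Section Descent.

(** [inW] is the domain on which [delta] is a homomorphism; by [inW_normal] it contains the
    conjugators produced by the induction. It differs from W only for (r, s) = (3, 2). *)
Variables (n : nat) (D : groupType) (inW : W -> Prop) (delta : W -> D) (tau : D -> D).
Hypotheses (tauM : {morph tau : x y / x * y}) (tauK : involutive tau).
Hypotheses (inWM : forall x y, inW x -> inW y -> inW (x * y))
  (inWV : forall x, inW x -> inW x^-1)
  (inW_gen : forall i, gen_index i -> inW (a i))
  (inW_level : forall x y, level_eq n x y -> inW x -> inW y)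
  (inW_normal : forall u, (forall x, Glevel n x -> Glevel n (x ^ u)) -> inW u).
Hypotheses (deltaM : forall x y, inW x -> inW y -> delta (x * y) = delta x * delta y)
  (delta_level : forall x y, level_eq n x y -> delta x = delta y)
  (delta_gen : forall i, gen_index i -> i != s -> i != r -> delta (a i) = 1)
  (delta_tau : delta (a r) = tau (delta (a s))).
(* [L] represents the group modulo [vertex_kernel n]. *)
Variable L : seq W.
Hypotheses (L1 : 1 \in L) (L_gam : forall x, x \in L -> gam x)
  (L_sr : forall i x, i = s \/ i = r -> x \in L ->
    exists2 y, y \in L & vertex_kernel n (a i * x * y^-1))
  (L_delta : forall x, x \in L -> delta x = 1 -> vertex_kernel n x).
Hypothesis delta_conj : forall u v b c b' c' x0 x1,
  inW u -> inW v -> Glevel n b -> Glevel n c -> Glevel n b' -> Glevel n c' ->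
  Glevel n x0 -> Glevel n x1 ->
  (forall j, sgn j.+1 (b * c)) ->
  delta b = tau (delta c) -> delta b' = tau (delta c') -> delta x1 = tau (delta x0) ->
  c * u = v * c' -> b * v = u * b' -> delta (x1 ^ v) = tau (delta (x0 ^ u)).

Lemma inW1 : inW 1.
Proof. by rewrite -(mulVg (a r)); apply: inWM; [apply: inWV|]; apply/inW_gen/indexr. Qed.

Lemma delta1 : delta 1 = 1.
Proof. by apply: (mulIg (delta 1)); rewrite -deltaM ?mul1g //; exact: inW1. Qed.

Lemma tau1 : tau 1 = 1.
Proof. by apply: (mulIg (tau 1)); rewrite -tauM !mul1g. Qed.

Lemma inW_gam x : gam x -> inW x.
Proof. by elim=> [|i y /inW_gen wi _ wy]; [exact: inW1 | exact: inWM]. Qed.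

Lemma inW_Glevel x : Glevel n x -> inW x.
Proof. by case=> y /inW_gam wy /inW_level; apply. Qed.

Definition twisted w := delta (sec w true) = tau (delta (sec w false)).

(** The condition survives an exchange of the sections because [tau] is an involution. *)
Lemma twistedM u v : (forall b, inW (sec u b)) -> (forall b, inW (sec v b)) ->
  twisted u -> twisted v -> twisted (u * v).
Proof.
move=> Wu Wv tu tv; rewrite /twisted !secM !deltaM // tauM -tv.
by case: (swap v); rewrite /= tu ?tauK.
Qed.

Lemma twisted_gen i : gen_index i -> twisted (a i).
Proof.
move=> ir; rewrite /twisted.
case: (genP ir) => [_|_|j _ jr js jNr]; rewrite ?sec_sigma ?sec_pair //.
  by rewrite delta1 tau1.
by rewrite delta_gen // delta1 tau1.
Qed.

Lemma twisted_gam x : gam x -> twisted x.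
Proof.
elim=> [|i y ir gy ty]; first by rewrite /twisted !sec1 delta1 tau1.
apply: twistedM ty => [b|b|]; last exact: twisted_gen.
  exact/inW_gam/gam_sec/gam_gen.
exact/inW_gam/gam_sec.
Qed.

Lemma twisted_Glevel w : Glevel n.+1 w -> twisted w.
Proof.
case=> x /twisted_gam + /level_eqS[_ xw].
by rewrite /twisted !(delta_level (xw _)).
Qed.

(** Elements of the vertex kernel have trivial [delta], since ([x], 1) in G is [twisted]. Hence the
    converse needs checking only on the representatives in [L]. *)
Lemma delta_ker x : gam x -> delta x = 1 -> vertex_kernel n x.
Proof.
move=> gx dx; suff [y yL xy] : exists2 y, y \in L & vertex_kernel n (x * y^-1).
  have gy := L_gam yL; rewrite -(mulgVK y x).
  apply: vertex_kernelM => //; apply: L_delta => //.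
  have gxy : gam (x * y^-1) := gamM gx (gamV gy).
  rewrite -[RHS]dx -[in RHS](mulgVK y x) deltaM; try exact: inW_gam.
  suff -> : delta (x * y^-1) = 1 by rewrite mul1g.
  have /twisted_Glevel := xy; rewrite /twisted !sec_pair delta1 => /(congr1 tau).
  by rewrite tau1 tauK.
(* Reduction to a representative letter by letter, the error term being conjugated past [a i]. *)
elim: {dx} gx => [|i {}x ir gx [y yL xy]].
  by exists 1; rewrite // mulgV; exact: vertex_kernel1.
have K' : vertex_kernel n ((x * y^-1) ^ (a i)^-1).
  exact/vertex_kernelJ/xy/gamV/gam_gen.
have E z : a i * x * z^-1 = (x * y^-1) ^ (a i)^-1 * (a i * y * z^-1).
  by rewrite conjgE invgK !mulgA !mulgVK.
have [isr|] := pselect (i = s \/ i = r).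
  have [z zL yz] := L_sr isr yL; exists z => //.
  by rewrite E; apply: vertex_kernelM.
move=> /not_orP[/eqP iNs /eqP iNr]; exists y => //; rewrite -mulgA.
by apply: vertex_kernelM xy; exact: vertex_kernel_gen.
Qed.

(** Lift the section at 0 to an element of G; the discrepancy at 1 then has trivial [delta], so it
    lies in the vertex kernel. *)
Lemma Glevel_twisted w : swap w = false -> (forall b, Glevel n (sec w b)) ->
  twisted w -> Glevel n.+1 w.
Proof.
move=> w0 Gw tw; have [x gx xw] := Gw false.
have [y [gy y0 yx]] := gam_lift gx.
have Gz : Glevel n ((sec y true)^-1 * sec w true).
  by apply: GlevelM (Gw true); apply/GlevelV/gam_Glevel/gam_sec.
have dz : delta ((sec y true)^-1 * sec w true) = 1.
  apply: (mulgI (delta (sec y true))); rewrite -deltaM; first last.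
  - exact: inW_Glevel.
  - exact/inW_gam/gam_sec.
  rewrite mulVKg mulg1 tw (twisted_gam gy) yx; congr tau.
  exact/esym/delta_level.
case: Gz => z gz zE.
have Gz : Glevel n.+1 (aut_pair 1 z).
  by apply/Glevel_pair_true/delta_ker; rewrite // (delta_level zE).
apply: Glevel_eq (GlevelM (gam_Glevel _ gy) Gz); apply/level_eqS.
rewrite swapM y0 w0; split=> // b; rewrite secM sec_pair swap_pair addbF.
case: b; last by rewrite mulg1 yx.
rewrite -[sec w true](mulVKg (sec y true)).
exact: level_eqM.
Qed.

Lemma odometer_normalS : odometer_normal n -> odometer_normal n.+1.
Proof.
move=> IHn g h w gG hG go ho.
(* Replacing [w] by [g * w] changes conjugation only by an element of G. *)
wlog w0 : w / swap w = false.
  case e: (swap w); last exact.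
  move=> main gw x Gx; have -> : x ^ w = (x ^ g^-1) ^ (g * w).
    by rewrite -conjgM mulKg.
  apply: main; first by rewrite swapM e -sgn1E (go 0).
    by rewrite [in LHS]gw mulgA.
  exact/GlevelJ/GlevelV.
move=> gw.
(* An [x] exchanging the letters is reduced to [g^-1 * x], as [g ^ w = h] is in G. *)
wlog e : / forall x, swap x = false -> Glevel n.+1 x -> Glevel n.+1 (x ^ w).
  move=> main; apply: (main) => x x0 Gx.
  have E b : sec (x ^ w) b = sec x b ^ sec w b.
    by rewrite conjgE !secE x0 w0 !addbF conjgE.
  set u := sec w false; set v := sec w true.
  (* When [g] is written as (b, c)sigma, b is its section at 1 and c its section at 0. *)
  have bu : sec g false * u = v * sec h false.
    by have := congr1 (sec^~ false) gw; rewrite !secM w0 -!sgn1E (ho 0).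
  have bv : sec g true * v = u * sec h true.
    by have := congr1 (sec^~ true) gw; rewrite !secM w0 -!sgn1E (ho 0).
  have odoM f b : (forall j, sgn j.+1 f) -> forall j, sgn j.+1 (sec f b * sec f (~~ b)).
    by move=> fo j; have := fo j.+1; rewrite sgnSS sgnM; case: b => //; rewrite addbC.
  have Gsec f b m : (forall k, Glevel k f) -> Glevel m (sec f b).
    by move=> fG; apply: Glevel_sec.
  have nu : forall y, Glevel n y -> Glevel n (y ^ u).
    apply: (IHn (sec g true * sec g false) (sec h true * sec h false)).
    - by move=> m; apply: GlevelM; apply: Gsec.
    - by move=> m; apply: GlevelM; apply: Gsec.
    - exact: (odoM g true).
    - exact: (odoM h true).
    by rewrite -mulgA bu !mulgA bv.
  have nv : forall y, Glevel n y -> Glevel n (y ^ v).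
    apply: (IHn (sec g false * sec g true) (sec h false * sec h true)).
    - by move=> m; apply: GlevelM; apply: Gsec.
    - by move=> m; apply: GlevelM; apply: Gsec.
    - exact: (odoM g false).
    - exact: (odoM h false).
    by rewrite -mulgA bv !mulgA bu.
  apply: Glevel_twisted; first by rewrite conjgE !secE x0 w0.
    by case; rewrite E; [apply: nv | apply: nu]; apply: Glevel_sec.
  rewrite /twisted !E.
  apply: (delta_conj (b := sec g true) (c := sec g false)
    (b' := sec h true) (c' := sec h false)) => //; try exact: Gsec;
    try exact: inW_normal; try exact: Glevel_sec; try exact: twisted_Glevel.
  exact: (odoM g true).
move=> x Gx; case x0: (swap x); last exact: e.
have -> : x ^ w = h * (g^-1 * x) ^ w.
  by rewrite conjMg conjVg (_ : g ^ w = h) ?mulVKg // conjgE gw mulKg.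
apply: GlevelM (hG _) (e _ _ _); first by rewrite swapM swapV x0 -sgn1E (go 0).
exact: GlevelM (GlevelV (gG _)) Gx.
Qed.

End Descent.

(** * Quotients D of order 4 *)

Lemma gen_involK i : gen_index i -> forall x, a i * (a i * x) = x.
Proof. by move=> ii x; rewrite mulgA gen_invol // mul1g. Qed.

(* [a k] is in the kernel, modulo which [a r] is thus equal to [a r ^ a k]. *)
Lemma klein_comm n k : gen_index k -> k != s -> k != r ->
  level_eq n (a s * a r ^ a k) (a r ^ a k * a s) ->
  vertex_kernel n (a r * a s * (a s * a r)^-1).
Proof.
move=> ik kNs kNr; have [is_ ir] := (indexs, indexr).
set A := a r ^ a k => comm; set q := a k * a k ^ a r.
have gA : gam A := gamJ (gam_gen ir) (gam_gen ik).
have kq : vertex_kernel n (q ^ a s).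
  apply: vertex_kernelJ (gam_gen is_) _.
  apply: vertex_kernelM; first exact: vertex_kernel_gen.
  by apply: vertex_kernelJ; [exact: gam_gen | exact: vertex_kernel_gen].
have AE : a r * a s = (A * a s) * q ^ a s.
  by rewrite /A /q !conjgE !genV // -!mulgA !gen_involK.
(* The inverse of [a s * a r] is [a r * a s], so the element is a square (YQ)^2 = Y^2 Q^Y Q with Q
   in the kernel. Y^2 is trivial at level [n] because [A] and [a s] are involutions commuting
   there. *)
rewrite invgM !genV // AE -mulgA (mulgA (q ^ a s)).
set Y := A * a s; set Q := q ^ a s in kq *.
have -> : Y * (Q * Y * Q) = Y * Y * (Q ^ Y * Q).
  by move: Y Q {kq} => Y Q; rewrite conjgE -!mulgA mulVKg.
apply: vertex_kernelM; last first.
  by apply: vertex_kernelM (kq); apply: vertex_kernelJ kq; apply: gamM (gam_gen is_).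
apply: vertex_kernel_eq (vertex_kernel1 n); apply: level_eq_sym.
have -> : 1 = A * (A * a s) * a s.
  by rewrite /A !conjgE genV // -!mulgA !gen_involK // gen_invol.
by rewrite /Y mulgA -(mulgA A (a s)); do 2?apply: level_eqM.
Qed.

(** D is abelian, so [delta] is unchanged by conjugation and the twist relation persists. The
    commutation hypothesis makes four words suffice as representatives. *)
Lemma odometer_normal_klein n k : (r <= n)%N -> gen_index k -> k != s -> k != r ->
  level_eq n (a s * a r ^ a k) (a r ^ a k * a s) ->
  odometer_normal n -> odometer_normal n.+1.
Proof.
move=> rn ik kNs kNr comm.
have sn : (s <= n)%N := leq_trans (ltnW s_lt_r) rn.
have sr : (s == r) = false by rewrite ltn_eqF.
(* Here D is the group {0, 1}^2, embedded in the larger type [dih]. *)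
pose delta x := Dih (sgn s x) (sgn r x) false.
pose tau x := Dih (dih1 x) (dih0 x) (dihs x).
have tauM : {morph tau : x y / x * y} by move=> [p q e] [p' q' []].
have tauK : involutive tau by case.
have Ecomm := klein_comm ik kNs kNr comm.
have gs := gam_gen indexs; have gr := gam_gen indexr.
have [ss rr] := (gen_invol indexs, gen_invol indexr).
have deltaE i : (i = s) \/ (i = r) -> delta (a i) = Dih (i == s) (i == r) false.
  by case=> ->; rewrite /delta !sgn_gen ?indexr ?indexs ?(ltnW s_lt_r) // ?(eq_sym r) ?sr !eqxx.
have deltaM x y : delta (x * y) = delta x * delta y by rewrite /delta !sgnM.
apply: (@odometer_normalS n dih (fun _ => True) delta tau tauM tauK _ _ _ _ _ _ _ _ _
  [:: 1; a s; a r; a s * a r]) => //.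
- by move=> x y xy; rewrite /delta !(sgn_level _ xy).
- by move=> i ir iNs iNr; rewrite /delta !sgn_gen ?(ltnW s_lt_r) // !(eq_sym _ i)
    (negbTE iNs) (negbTE iNr).
- by rewrite !deltaE /tau /= ?(eq_sym r) ?sr ?eqxx; auto.
- by rewrite inE eqxx.
- move=> x; rewrite !inE => /or4P[] /eqP-> //; first exact: gam_1.
  exact: gamM.
- have K x : vertex_kernel n (x * x^-1) by rewrite mulgV; exact: vertex_kernel1.
  move=> i x [] ->; rewrite !inE => /or4P[] /eqP->.
  + by exists (a s); rewrite ?mulg1 // !inE eqxx orbT.
  + by exists 1; rewrite ?ss // !inE eqxx.
  + by exists (a s * a r); rewrite // !inE eqxx !orbT.
  + by exists (a r); rewrite ?mulgA ?ss ?mul1g // !inE eqxx !orbT.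
  + by exists (a r); rewrite ?mulg1 // !inE eqxx !orbT.
  + by exists (a s * a r); rewrite // !inE eqxx !orbT.
  + by exists 1; rewrite ?rr // !inE eqxx.
  + exists (a s); first by rewrite !inE eqxx !orbT.
    by move: Ecomm; rewrite invgM !genV ?indexr ?indexs // !mulgA.
- have d1 : (1 : dih) = Dih false false false by [].
  move=> x; rewrite !inE => /or4P[] /eqP->; rewrite ?deltaM ?deltaE; auto;
    rewrite ?(eq_sym r) ?sr ?eqxx // => _.
  exact: vertex_kernel1.
- by move=> u v b c b' c' x0 x1 _ _ _ _ _ _ _ _ _ _ _ + _ _;
    rewrite /delta /tau !sgnJ.
Qed.

Lemma gen_prev i : gen_index i -> i != 1%N -> i != s.+1 -> a i = aut_pair (a i.-1) 1.
Proof. by move=> ii; case: (genP ii) => [->|->|j ->]; rewrite ?eqxx. Qed.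

(** Here [a s] and [a r] both act below the vertex 0; conjugating [a r] by sigma moves it below 1,
    where it commutes with [a s]. *)
Lemma odometer_normal_far n : (1 < s)%N -> (s.+1 < r)%N -> odometer_normal n.
Proof.
move=> s1 sr; have [/odometer_normal_small//|/ltnW rn] := leqP n r.
rewrite -(subnK rn); elim: (n - r)%N => [|m IHm].
  exact: odometer_normal_small.
apply: (odometer_normal_klein (k := 1)) IHm; rewrite ?leq_addl ?index1 ?ltn_eqF //.
  exact: leq_trans sr.
have prs : a s = aut_pair (a s.-1) 1.
  by rewrite {1}gen_prev ?indexs // neq_ltn ?ltnSn ?s1 ?orbT.
have -> : a r = aut_pair (a r.-1) 1.
  rewrite {1}gen_prev ?indexr // neq_ltn ?sr ?orbT //.
  by rewrite (leq_trans s1 (ltnW s_lt_r)) orbT.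
by rewrite gen1E prs pair_sigma pair_comm.
Qed.

(** Now [a r] = ([a s], [a r]), and [a 2] = (sigma, 1) moves its first component away from the
    support of [a s.-1]; this uses [s > 2]. *)
Lemma odometer_normal_near n : (2 < s)%N -> r = s.+1 -> odometer_normal n.
Proof.
move=> s2 rE; have [/odometer_normal_small//|/ltnW rn] := leqP n r.
rewrite -(subnK rn); elim: (n - r)%N => [|m IHm].
  exact: odometer_normal_small.
have s1 : (1 < s)%N by apply: ltnW.
have i2 : gen_index 2 by rewrite /gen_index ltnW // rE.
have is1 : gen_index s.-1.
  rewrite /gen_index -ltnS prednK // s1 rE.
  exact: leq_trans (leq_pred s) _.
apply: (odometer_normal_klein (k := 2)) IHm; rewrite ?leq_addl ?ltn_eqF //.
  by rewrite rE ltnS ltnW.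
suff -> : a s * a r ^ a 2 = a r ^ a 2 * a s by [].
have -> : a 2 = aut_pair sigma 1.
  by rewrite gen_prev ?gen1E // eqSS neq_ltn s1.
have prs : a s = aut_pair (a s.-1) 1.
  by rewrite {1}gen_prev ?indexs // neq_ltn ?ltnSn ?s1 ?orbT.
have -> : a r = aut_pair (a s) (a r) by rewrite {1}rE gensE.
rewrite prs !conjgE aut_pairV !aut_pairM.
rewrite !(invg1, mulg1, mul1g) -conjgE; congr aut_pair.
rewrite pair_sigma (gen_prev is1) ?pair_comm // neq_ltn.
  by rewrite -[X in _ || (_ < X)%N]/(s.-1) orbC -ltnS prednK ?s2.
by rewrite ltnS leq_pred.
Qed.

(** The quotient of order 8 for (3, 2) reads words of length 4, so its induction starts at level 4.
    From level 3 to 4 the order 4 argument still works, because [a 3] is trivial on words of length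
    2. *)
Lemma odometer_normal_small23 n : s = 2 -> r = 3 -> (n <= 4)%N -> odometer_normal n.
Proof.
move=> s2 r3; have [nr _|rn n4] := leqP n r; first exact: odometer_normal_small.
have -> : n = 4 by apply/eqP; rewrite eqn_leq n4 -r3.
have ir := indexr; rewrite r3 in ir *.
have small := @odometer_normal_small 3; rewrite r3 in small.
have ks := @odometer_normal_klein 3 1; rewrite r3 s2 in ks.
apply: ks (small _) => //.
  exact: index1.
have -> : a 3 = aut_pair (a 2) (a 3) by have := gensE; rewrite s2 r3.
have -> : a 2 = aut_pair sigma 1 by rewrite gen_prev ?gen1E ?s2 // /gen_index r3.
rewrite gen1E pair_sigma !aut_pairM mul1g mulg1; apply/level_eqS; split=> // -[].
  by rewrite !sec_pair.
rewrite !sec_pair; have t := gen_trivial ir (leqnn 3).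
apply: (level_eq_trans (v := sigma * 1)); first exact: level_eqM.
by rewrite mulg1 -{1}[sigma]mul1g; apply/level_eqM/level_eq_refl/level_eq_sym.
Qed.

(** * Quotients D of order 8 *)

(** Normal forms in the dihedral group generated by the involutions [a s] and [a r] with
    ([a s * a r])^2 = ([a r * a s])^2. *)
Definition dihedral_words :=
  [:: 1; a s; a r; a s * a r; a r * a s; a s * (a r * a s); a r * (a s * a r);
      a s * (a r * (a s * a r))].

Lemma dihedral_wordsM i x : a s * (a r * (a s * a r)) = a r * (a s * (a r * a s)) ->
  i = s \/ i = r -> x \in dihedral_words -> a i * x \in dihedral_words.
Proof.
move=> braid; have [ss rr] := (gen_invol indexs, gen_invol indexr).
have [sK rK] := (gen_involK indexs, gen_involK indexr).
case=> ->; rewrite !inE => /or4P[|||/or4P[|||/orP[]]] /eqP->;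
  by rewrite ?sK ?braid ?mulg1 ?ss ?rr ?sK ?rK -?braid !eqxx ?orbT.
Qed.

Lemma odometer_normal_dih n (inW : W -> Prop) (delta : W -> dih) : (r <= n)%N ->
  (forall x y, inW x -> inW y -> inW (x * y)) ->
  (forall x, inW x -> inW x^-1) ->
  (forall i, gen_index i -> inW (a i)) ->
  (forall x y, level_eq n x y -> inW x -> inW y) ->
  (forall u, (forall x, Glevel n x -> Glevel n (x ^ u)) -> inW u) ->
  (forall x y, inW x -> inW y -> delta (x * y) = delta x * delta y) ->
  (forall x y, level_eq n x y -> delta x = delta y) ->
  (forall i, gen_index i -> i != s -> i != r -> delta (a i) = 1) ->
  delta (a s) = Dih false false true -> delta (a r) = Dih true false false ->
  a s * (a r * (a s * a r)) = a r * (a s * (a r * a s)) ->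
  odometer_normal n -> odometer_normal n.+1.
Proof.
move=> rn WM WV Wg Wl Wn dM dl dg ds dr braid.
have gs := gam_gen indexs; have gr := gam_gen indexr.
have W1 : inW 1 by rewrite -(mulVg (a r)); apply: WM; [apply: WV|]; apply/Wg/indexr.
have d1 : delta 1 = 1 by apply: (mulIg (delta 1)); rewrite -dM ?mul1g.
have Wgam x : gam x -> inW x by elim=> // i y /Wg wi _; apply: WM.
have WG x : Glevel n x -> inW x by case=> y /Wgam wy /Wl; apply.
(* The two characters of D pull back to the signatures at levels [s] and [r]. Both are 1 on the
   odometer [b * c], whose image is thus a rotation of order 4. *)
have par x : gam x -> dihs (delta x) = sgn s x /\ dih0 (delta x) (+) dih1 (delta x) = sgn r x.
  elim=> [|i y ii gy [ys yr]]; first by rewrite d1 !sgn_one.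
  rewrite dM ?sgnM -?ys -?yr; [|exact: Wg|exact: Wgam].
  have sr : (s == r) = false by rewrite ltn_eqF.
  rewrite !(sgn_gen ii) ?(ltnW s_lt_r) //.
  have [->|iNs] := eqVneq i s.
    by rewrite ds eq_sym sr; case: (delta y) => [[] [] []].
  have [->|iNr] := eqVneq i r.
    by rewrite dr; case: (delta y) => [[] [] []].
  by rewrite dg // mul1g.
apply: (@odometer_normalS n dih inW delta dih_tau dih_tauM dih_tauK WM WV Wg Wl
  Wn dM dl dg _ dihedral_words).
- by rewrite ds dr.
- by rewrite inE eqxx.
- by move=> x; rewrite !inE => /or4P[|||/or4P[|||/orP[]]] /eqP->;
    do ?[exact: gam_1 | exact: gs | exact: gr | apply: gamM].
- move=> i x ii xw; exists (a i * x); first exact: dihedral_wordsM.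
  by rewrite mulgV; exact: vertex_kernel1.
- move=> x; rewrite !inE => /or4P[|||/or4P[|||/orP[]]] /eqP->;
    first by move=> _; exact: vertex_kernel1.
  all: rewrite ?dM ?ds ?dr //;
    do ?[exact: Wgam gs | exact: Wgam gr | apply: (WM)].
move=> u v b c b' c' x0 x1 Wu Wv Gb Gc Gb' Gc' G0 G1 odd dbc dbc' dx cu bv.
have dV x : inW x -> delta x^-1 = (delta x)^-1.
  by move=> Wx; apply: (mulIg (delta x)); rewrite -dM ?mulVg ?d1 //; exact: WV.
have dJ x y : inW x -> inW y -> delta (x ^ y) = delta x ^ delta y.
  by move=> Wx Wy; rewrite !conjgE !dM ?dV //; [exact: WV | exact: WM].
rewrite !dJ; try exact: WG; try by [].
have [z gz zE] := GlevelM Gb Gc.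
have [par1 par2] := par z gz.
rewrite (dl _ _ zE) dM in par1 par2; try exact: WG.
apply: (dih_conj (b := delta b) (c := delta c) (b' := delta b') (c' := delta c')) => //.
- rewrite par1 (sgn_level _ zE) ?(leq_trans (ltnW s_lt_r)) //.
  by case: (s) s_ge1 => // j _; exact: odd.
- rewrite par2 (sgn_level _ zE) //.
  by case: (r) s_lt_r => // j _; exact: odd.
- by rewrite -!dM ?cu //; exact: WG.
- by rewrite -!dM ?bv //; exact: WG.
Qed.

(** Here [a s] = sigma and [a r] = ([a r.-1], 1), so [delta] is defined on all of W by replacing
    each section by its signature at level [r.-1]. *)
Lemma odometer_normal_s1 n : s = 1%N -> (2 < r)%N -> odometer_normal n.
Proof.
move=> s1 r2; have [/odometer_normal_small//|/ltnW rn] := leqP n r.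
rewrite -(subnK rn); elim: (n - r)%N => [|m IHm].
  exact: odometer_normal_small.
have aE : a s = sigma by rewrite s1 gen1E.
have arE : a r = aut_pair (a r.-1) 1.
  by rewrite gen_prev ?indexr // ?s1 neq_ltn ?r2 ?(ltnW r2) orbT.
have rP : r.-1.+1 = r by rewrite prednK // ltnW // ltnW.
have r1F : (r.-1 == 1%N) = false by rewrite -eqSS rP gtn_eqF.
have rrF : (r.-1 == r) = false by rewrite -{2}rP ltn_eqF.
have ir1 : gen_index r.-1 by rewrite /gen_index leq_pred -ltnS rP ltnW.
pose delta x := Dih (sgn r.-1 (sec x false)) (sgn r.-1 (sec x true)) (swap x).
apply: (odometer_normal_dih (inW := fun _ => True) (delta := delta)) IHm => //.
- exact: leq_addl.
- move=> x y _ _; rewrite /delta !secM swapM !sgnM.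
  by case: (swap y).
- move=> x y; rewrite -[in (_ + _)%N]rP addnS => /level_eqS[e xy].
  by rewrite /delta e !(sgn_level _ (xy _)) ?leq_addl.
- move=> i ii iNs iNr; rewrite /delta; case: (genP ii) iNs iNr => [->|->|j -> ij js jr].
  + by rewrite s1.
  + move=> _ _; rewrite !sec_pair s1 !sgn_gen ?leq_pred ?index1 ?indexr //.
    by rewrite r1F rrF.
  + move=> _ jNr; rewrite !sec_pair sgn_one sgn_gen ?leq_pred //.
    by rewrite -eqSS rP eq_sym (negbTE jNr).
- by rewrite /delta aE !sec_sigma sgn_one.
- by rewrite /delta arE !sec_pair sgn_one sgn_gen ?leq_pred // eqxx.
by rewrite aE arE; apply: aut_ext; rewrite !secE ?(mulg1, mul1g).
Qed.

Lemma odometer_normal_23 n : s = 2 -> r = 3 -> odometer_normal n.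
Proof.
move=> s2 r3; have [/odometer_normal_small23|/ltnW rn] := leqP n 4; first exact.
rewrite -(subnK rn); elim: (n - 4)%N => [|m IHm].
  exact: odometer_normal_small23.
have i1 := index1; have i2 : gen_index 2 by rewrite -s2 indexs.
have i3 : gen_index 3 by rewrite -r3 indexr.
have a1 := gen1E.
have a2 : a 2 = aut_pair (a 1) 1 by rewrite gen_prev // s2.
have a3 : a 3 = aut_pair (a 2) (a 3) by have := gensE; rewrite s2 r3.
(* [th] is 1 on [a 1] and [a 2] and 0 on [a 3], so both sections ([a 1], 1) and ([a 2], [a 3]) of
   [a 3] show the same values. *)
pose th x := sgn 1 x (+) sgn 2 x.
have thM x y : th (x * y) = th x (+) th y by rewrite /th !sgnM addbACA.
pose S x b c := th (sec (sec x b) c).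
(* [H p := Dih (th p_0) (th p_1) (swap p)] is a homomorphism, and [delta x] is the
   class of (H x_0, H x_1) modulo the pairs (alpha, alpha) and (zeta, zeta), where
   alpha = Dih 0 0 1 and zeta = Dih 1 1 0 is central; this is a homomorphism on the
   subgroup [inW], where H x_0 and H x_1 have the same parity. *)
pose T x b := S x b false (+) S x b true.
pose inW x := T x false == T x true.
pose delta x := Dih (S x false false (+) S x true true)
  (S x false true (+) S x true true) (swap (sec x false) (+) swap (sec x true)).
have SM x y b c : S (x * y) b c =
    S x (b (+) swap y) (c (+) swap (sec y b)) (+) S y b c.
  by rewrite /S !secM thM.
have TM x y b : T (x * y) b = T x (b (+) swap y) (+) T y b.
  rewrite /T !SM addbACA; congr (_ (+) _).
  by case: (swap (sec y b)); rewrite //= addbC.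
have inWM x y : inW x -> inW y -> inW (x * y).
  by rewrite /inW !TM => /eqP Tx /eqP Ty; case: (swap y); rewrite /= Tx Ty.
(* On [inW] this eliminates the bits [S x b true], and multiplicativity of [delta] becomes a boolean
   check. *)
have inWS x b c : inW x -> S x b c = S x b false (+) (c && T x false).
  move/eqP => E; have -> : T x false = T x b by case: b.
  by case: c; rewrite /T ?addbF // addKb.
have deltaM x y : inW x -> inW y -> delta (x * y) = delta x * delta y.
  move=> Wx Wy; rewrite /delta !SM.
  rewrite !(inWS x _ (_ (+) _)) // !(inWS x _ true) // !(inWS y _ true) // !secM !swapM.
  congr Dih => /=.
  - case: (swap y); case: (swap (sec y false)); case: (swap (sec y true)) => /=;
    case: (T x false); case: (T y false); case: (S x false false);
    case: (S x true false); case: (S y false false); by case: (S y true false).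
  - case: (swap y); case: (swap (sec y false)); case: (swap (sec y true)) => /=;
    case: (T x false); case: (T y false); case: (S x false false);
    case: (S x true false); case: (S y false false); by case: (S y true false).
  by rewrite addbACA; case: (swap y) => //=; rewrite (addbC (swap (sec x true))).
have T1 b : T 1 b = false by rewrite /T /S !sec1 /th !sgn_one.
have TV x b : T x^-1 b = T x (b (+) swap x).
  have := TM x^-1 x (b (+) swap x); rewrite mulVg T1 -addbA addbb addbF.
  by case: (T x^-1 b); case: (T x _).
have thE : [/\ th 1 = false, th (a 1) = true, th (a 2) = true & th (a 3) = false].
  by rewrite /th !sgn_one !(sgn_gen i1) ?(sgn_gen i2) ?(sgn_gen i3) // ?r3.
have [th1 tha1 tha2 tha3] := thE.
have S1 b c : S (a 1) b c = false by rewrite a1 /S sec_sigma sec1 th1.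
have S2 b c : S (a 2) b c = false.
  by rewrite a2 /S sec_pair; case: b; rewrite ?a1 ?sec_sigma ?sec1 th1.
have S3 b c : S (a 3) b c = ~~ c.
  rewrite a3 /S sec_pair; case: b; [rewrite a3 | rewrite a2]; rewrite sec_pair.
    by case: c; rewrite ?tha3 ?tha2.
  by case: c; rewrite ?th1 ?tha1.
have index3 i : gen_index i -> [\/ i = 1%N, i = 2 | i = 3].
  rewrite /gen_index r3; case: i => [|[|[|[|]]]] //; first by constructor 1.
    by constructor 2.
  by constructor 3.
(* The twist relation of the order 4 quotient, used to place conjugators in [inW]. *)
have klein y : gam y -> sgn 2 (sec y false) = sgn 3 (sec y true) /\
    sgn 3 (sec y false) = sgn 2 (sec y true).
  elim=> [|i x ii gx [x1 x2]]; first by rewrite !sec1 !sgn_one.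
  rewrite !secM !sgnM x1 x2; case: (index3 _ ii) => ->.
  - by rewrite a1 !sec_sigma !sgn_one.
  - rewrite a2 !sec_pair; case: (swap x) => /=;
    by rewrite ?sgn_one !(sgn_gen i1) ?r3.
  - rewrite a3 !sec_pair; case: (swap x) => /=;
    by rewrite !(sgn_gen i2) ?(sgn_gen i3) ?r3.
have TE x b : T x b = sgn 2 (sec x b) (+) sgn 3 (sec x b).
  by rewrite /T /S /th addbACA.
have SL x y b c : level_eq (m + 4) x y -> S x b c = S y b c.
  rewrite addn4 => /level_eqS[_ /(_ b)] /level_eqS[_ /(_ c)] xy.
  by rewrite /S /th !(sgn_level _ xy).
apply: (odometer_normal_dih (inW := inW) (delta := delta)) IHm => //.
- by rewrite r3 addn4.
- move=> x; rewrite /inW !TV => /eqP Tx; by case: (swap x); rewrite /= Tx.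
- move=> i ii; rewrite /inW /T; case: (index3 _ ii) => ->;
  by rewrite ?S1 ?S2 ?S3.
- by move=> x y xy; rewrite /inW /T !(SL x y).
(* The involution [sigma ^ u] exchanges the letters, so its sections are mutually inverse and share
   their signatures. With [klein] this gives [T y false = false], that is, equality of the two
   values of [T u]. *)
- move=> u nu; have Gy := nu _ (Glevel_sigma _); set y := sigma ^ u in Gy.
  have Ty : T y false = T u true (+) T u false.
    have Ts b : T sigma b = false by rewrite -a1 /T !S1.
    by rewrite /y conjgE !TM TV Ts swapM swap_sigma; case: (swap u).
  have y0 : swap y = true by rewrite /y conjgE !secE; case: (swap u).
  have yy : y * y = 1.
    by rewrite -conjMg -a1 (gen_invol i1) conj1g.
  have yV j : sgn j (sec y true) = sgn j (sec y false).
    have := sgn_one j; rewrite -(sec1 false) -yy secM y0 sgnM.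
    by do 2!case: (sgn j _).
  have yK : sgn 2 (sec y false) = sgn 3 (sec y true).
    case: Gy => z /klein[+ _]; rewrite addn4 => + /level_eqS[_ zy].
    by rewrite !(sgn_level _ (zy _)).
  move: Ty; rewrite TE yK yV addbb /inW.
  by case: (T u false); case: (T u true).
- move=> x y; have := SL x y; rewrite /delta addn4 => xyS xy; rewrite !xyS //.
  by move/level_eqS: xy => [_ xy]; rewrite -!sgn1E !(sgn_level _ (xy _)).
- move=> i ii; case: (index3 _ ii) => ->; rewrite ?s2 ?r3 // => _ _.
  by rewrite /delta !S1 a1 !sec_sigma.
- by rewrite s2 /delta !S2 a2 !sec_pair a1.
- by rewrite r3 /delta !S3 a3 !sec_pair a2 a3.
- rewrite s2 r3 a3 a2 a1; have a33 := gen_invol i3.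
  have a31 : sec (a 3) true = a 3 by rewrite {1}a3 sec_pair.
  apply: aut_ext; rewrite !secE //=.
  + by apply: aut_ext; rewrite !secE ?(mulg1, mul1g).
  + by rewrite !(mul1g, mulg1) a33.
Qed.

(** * The infinite dihedral case *)

(** Modulo level [n], both generators invert the odometers [g] and [h], so [a i * a i ^ w]
    centralizes [h] and is a power of [h]; hence [a i ^ w] is in G. *)
Lemma odometer_normal_12 n : s = 1%N -> r = 2 -> odometer_normal n.
Proof.
move=> s1 r2; have [/odometer_normal_small//|rn] := leqP n r.
have i1 : gen_index 1 := index1; have i2 : gen_index 2 by rewrite -r2 indexr.
set x := a 1; set y := a 2.
have [xx yy] : x * x = 1 /\ y * y = 1 by rewrite !gen_invol.
have index2 i : gen_index i -> i = 1%N \/ i = 2.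
  by rewrite /gen_index r2; case: i => [|[|[|]]] // _; [left | right].
(* Words of even length are inverted by the generators. *)
have gam_even u : gam u -> sgn 1 u -> sgn 2 u -> u ^ x = u^-1 /\ u ^ y = u^-1.
  suff /[apply] : forall u, gam u -> exists z, [/\ z ^ x = z^-1, z ^ y = z^-1,
      sgn 1 z = sgn 2 z & u = z \/ u = x * z].
    (* The alternative [u = x * z] is excluded: its signatures at levels 1 and 2 differ. *)
    move=> [z [zx zy z12 [->//|->]]]; rewrite !sgnM z12 !(sgn_gen i1) ?r2 //=.
    by case: (sgn 2 z).
  move=> {}u; elim=> [|i v ii _ [z [zx zy z12 vE]]].
    by exists 1; rewrite !conj1g invg1 !sgn_one; split=> //; left.
  have [->|->] := index2 _ ii; rewrite -/x -/y.
    exists z; split=> //; case: vE => ->; first by right.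
    by left; rewrite mulgA xx mul1g.
  have yx12 : sgn 1 (y * x * z) = sgn 2 (y * x * z).
    by rewrite !sgnM z12 !(sgn_gen i1) ?(sgn_gen i2) ?r2.
  have xy12 : sgn 1 (x * y * z) = sgn 2 (x * y * z).
    by rewrite !sgnM z12 !(sgn_gen i1) ?(sgn_gen i2) ?r2.
  case: vE => ->.
    exists (x * y * z); have [? ?] := rotation_inverted xx yy zx zy.
    by split=> //; right; rewrite !mulgA xx mul1g.
  exists (y * x * z); have [? ?] := rotation_inverted yy xx zy zx.
  by split=> //; left; rewrite mulgA.
have gx u : (forall j, sgn j.+1 u) -> (forall m, Glevel m u) -> forall i, gen_index i ->
    level_eq n (u ^ a i) u^-1.
  move=> uo uG i ii; have [z gz zu] := uG n.
  have z12 : sgn 1 z /\ sgn 2 z.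
    have n2 : (1 < n)%N by rewrite ltnW // -r2.
    by rewrite !(sgn_level _ zu) ?(uo 0) ?(uo 1%N) // ltnW.
  apply: level_eq_trans (level_eqV zu).
  apply: level_eq_trans (level_eqJ (level_eq_sym zu) (@level_eq_refl n (a i))) _.
  have [zx zy] := gam_even _ gz z12.1 z12.2.
  by case: (index2 _ ii) => ->; rewrite -/x -/y ?zx ?zy.
move=> g h w gG hG go ho gw v [v' gv' vv'].
suff main i : gen_index i -> Glevel n (a i ^ w).
  apply: Glevel_eq (level_eqJ vv' (@level_eq_refl n w)) _.
  elim: gv' {vv'} => [|i u ii _ IHu]; first by rewrite conj1g; exact: Glevel1.
  by rewrite conjMg; apply: GlevelM => //; apply: main.
move=> ii; have hE : h = g ^ w by rewrite conjgE gw mulKg.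
have hz : level_eq n (h ^ (a i * a i ^ w)) h.
  rewrite conjgM; apply: (level_eq_trans (v := h^-1 ^ (a i ^ w))).
    exact: level_eqJ (gx h ho hG i ii) _.
  rewrite hE -conjVg -conjJg; apply: level_eqJ => //.
  by rewrite conjVg -[X in level_eq n _ X]invgK; apply: level_eqV; exact: gx.
have [k kE] : exists k, level_eq n (a i * a i ^ w) (h ^+ k).
  apply: odometer_centralizer => //; rewrite (conjgC h).
  exact: level_eqM (level_eq_sym hz).
have -> : a i ^ w = a i * (a i * a i ^ w) by rewrite mulgA gen_invol // mul1g.
apply: GlevelM (Glevel_gen n ii) _; apply: Glevel_eq (level_eq_sym kE) _.
elim: k {kE} => [|k IHk]; first exact: Glevel1.
by rewrite expgS; apply: GlevelM.
Qed.

(** * Assembly of the cases, and conjugacy of odometers *)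

Lemma odometer_normal_all n : odometer_normal n.
Proof.
have [s1|s1] := eqVneq s 1%N.
  have [r2|r2] := eqVneq r 2; first exact: odometer_normal_12.
  by apply: odometer_normal_s1; rewrite // ltn_neqAle eq_sym r2 -s1.
have {}s1 : (1 < s)%N by rewrite ltn_neqAle eq_sym s1.
have [rs|rs] := eqVneq r s.+1; last first.
  by apply: odometer_normal_far; rewrite // ltn_neqAle eq_sym rs.
have [s2|s2] := eqVneq s 2; first by apply: odometer_normal_23; rewrite // rs s2.
by apply: odometer_normal_near; rewrite // ltn_neqAle eq_sym s2.
Qed.

End Generators.

Local Open Scope classical_set_scope.

Theorem theorem3p9p4 (r s : nat) (s_ge1 : (1 <= s)%N) (s_lt_r : (s < r)%N)
    (a : nat -> W) (a_rec : generator_recursion r s a)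
    (G : set W)
    (G_def : G = closed_subgroup_generated (a @` [set i | (1 <= i <= r)%N]))
    (g h : W) (gG : G g) (hG : G h) (g_odo : odometer g) (h_odo : odometer h) :
  exists w, normalizer G w /\ h = g ^ w.
Proof.
(* Both are conjugates of the one standard odometer. *)
have [w hE] : exists w, h = g ^ w.
  case: g_odo h_odo => [b [u [bE ->]]] [c [v [cE ->]]]; exists (u^-1 * v).
  have [o [_ oU]] := standard_odometer_exists_unique.
  by rewrite -(oU _ bE) -(oU _ cE) -conjgM mulVKg.
exists w; split=> //.
have P := odometer_normal_all s_ge1 s_lt_r a_rec.
exact: (odometer_normal_normalizer s_ge1 s_lt_r a_rec G_def P gG hG).
Qed.
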